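(* Let $\Gamma$ be a locally compact Hausdorff abelian group with Haar measure $\lambda$, and let $(\Sigma,\iota,\pi)$ be a $\Gamma$-twist over a locally compact Hausdorff groupoid $G$ with Haar system $\{\lambda^u\}_{u\in G^{(0)}}$. Let $\mathfrak{s}:G\to\Sigma$ be a (not necessarily continuous) section of $\pi$. For each $u\in\Sigma^{(0)}\equiv G^{(0)}$ let $\mu^u$ be the unique Radon measure on $\Sigma$ satisfying $$\int_\Sigma f(\sigma)\,d\mu^u(\sigma)=\int_{G^u}\int_\Gamma f(\alpha\cdot\mathfrak{s}(\gamma))\,d\lambda(\alpha)\,d\lambda^u(\gamma)\qquad\text{for all } f\in\mathcal{C}_c(\Sigma).$$ Then $\{\mu^u\}_{u\in\Sigma^{(0)}}$ is a Haar system for $\Sigma$.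
   Context: A locally compact Hausdorff groupoid is a topological groupoid (continuous multiplication and inversion) whose topology is locally compact Hausdorff; $G^{(0)}$ is the unit space, $r,s$ the range and source maps, $G^u=r^{-1}(u)$. $\Gamma$-twist: let $\Gamma$ have identity $e$, and regard $G^{(0)}\times\Gamma$ as the trivial group bundle with fibres $\Gamma$ (so $(u,\alpha)(u,\beta)=(u,\alpha\beta)$, unit space $G^{(0)}\times\{e\}\equiv G^{(0)}$). A $\Gamma$-twist $(\Sigma,\iota,\pi)$ over $G$ is a locally compact Hausdorff groupoid $\Sigma$ with unit space $\Sigma^{(0)}=\iota(G^{(0)}\times\{e\})$ and maps $\iota:G^{(0)}\times\Gamma\to\Sigma$, $\pi:\Sigma\to G$ such that: (i) $\iota,\pi$ are continuous groupoid homomorphisms, $\iota$ a topological embedding and $\pi$ a quotient map, which restrict to homeomorphisms of unit spaces; one identifies $\Sigma^{(0)}=G^{(0)}$ via $\pi|_{\Sigma^{(0)}}$; (ii) $\iota$ is injective, $\pi$ is surjective and $\iota(G^{(0)}\times\Gamma)=\pi^{-1}(G^{(0)})$; (iii) for all $\sigma\in\Sigma$, $\alpha\in\Gamma$, $\iota(r(\sigma),\alpha)\sigma=\sigma\iota(s(\sigma),\alpha)$ (in particular these products are defined). The action of $\Gamma$ on $\Sigma$ is $\alpha\cdot\sigma:=\iota(r(\sigma),\alpha)\sigma$. The inner integral $f_G(\gamma):=\int_\Gamma f(\alpha\cdot\mathfrak{s}(\gamma))\,d\lambda(\alpha)$ does not depend on $\mathfrak{s}$ and defines a function in $\mathcal{C}_c(G)$,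 so the right-hand side is a well-defined positive linear functional on $\mathcal{C}_c(\Sigma)$ and $\mu^u$ exists by the Riesz representation theorem. A Haar system for a locally compact Hausdorff groupoid $H$ is a family $\{\nu^u\}_{u\in H^{(0)}}$ of Radon measures on $H$ such that: $\operatorname{supp}\nu^u=H^u$ for each $u$; for each $f\in\mathcal{C}_c(H)$ the map $u\mapsto\int f\,d\nu^u$ is continuous on $H^{(0)}$; and $\int f(\sigma\tau)\,d\nu^{s(\sigma)}(\tau)=\int f(\tau)\,d\nu^{r(\sigma)}(\tau)$ for all $\sigma\in H$ and $f\in\mathcal{C}_c(H)$. *)

(* Defs.v *)
From HB Require Import structures.
From mathcomp Require Import all_boot all_order all_algebra.
From mathcomp Require Import complex.
From mathcomp Require Import all_classical all_reals all_analysis.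

Set Implicit Arguments.
Unset Strict Implicit.
Unset Printing Implicit Defensive.

Import Order.TTheory GRing.Theory Num.Theory.
Import numFieldNormedType.Exports.

Local Open Scope classical_set_scope.
Local Open Scope ring_scope.

HB.mixin Record Topological_isLCH T & Topological T := {
  lch_hausdorff : hausdorff_space T;
  lch_locally_compact : locally_compact [set: T]
}.

#[short(type="lchType")]
HB.structure Definition LCHSpace := {T of Topological T & Topological_isLCH T}.

#[short(type="lcaGroupType")]
HB.structure Definition LCAGroup :=
  {T of LCHSpace T & TopologicalZmodule T}.

(* Operations on groupoids are total; [gmul a b] is only meaningful when
   [composable (a, b)]. The unit space is the subset [units] below. *)
HB.mixin Record isGroupoid G := {
  composable : set (G * G);
  gmul : G -> G -> G;
  ginv : G -> G;
  gmulA : forall a b c, composable (a, b) -> composable (b, c) ->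
    [/\ composable (gmul a b, c), composable (a, gmul b c) &
        gmul (gmul a b) c = gmul a (gmul b c)];
  ginvK : forall a, ginv (ginv a) = a;
  composableV : forall a, composable (a, ginv a);
  gmulKV : forall a b, composable (a, b) -> gmul (ginv a) (gmul a b) = b;
  gmulVK : forall a b, composable (a, b) -> gmul (gmul a b) (ginv b) = a
}.

#[short(type="groupoidType")]
HB.structure Definition Groupoid := {G of isGroupoid G}.

HB.mixin Record Groupoid_isTopological G & Topological G & isGroupoid G := {
  gmul_continuous : {within @composable G,
    continuous (fun p : G * G => gmul p.1 p.2)};
  ginv_continuous : continuous (@ginv G)
}.

#[short(type="lchGroupoidType")]
HB.structure Definition LCHGroupoid :=
  {G of LCHSpace G & Groupoid G & Groupoid_isTopological G}.

Section groupoid_theory.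
Variable G : groupoidType.
Implicit Types a b u : G.

Definition grange a : G := gmul a (ginv a).
Definition gsource a : G := gmul (ginv a) a.
Definition units : set G := range grange.
Definition rfibre u : set G := [set a | grange a = u].

Lemma composableVl a : composable (ginv a, a).
Proof. by rewrite -{2}(ginvK a); exact: composableV. Qed.

Lemma composable_source_range a b : composable (a, b) -> gsource a = grange b.
Proof.
move=> ab; have [sab _ e] := gmulA _ _ _ (composableVl a) ab.
by have := gmulVK _ _ sab; rewrite e gmulKV.
Qed.

Lemma source_range_composable a b : gsource a = grange b -> composable (a, b).
Proof.
move=> e; have [_ sa _] := gmulA _ _ _ (composableV a) (composableVl a).
have [rb _ rbE] := gmulA _ _ _ (composableV b) (composableVl b).
have {}sa : composable (a, grange b) by rewrite -e.
have [_ + _] := gmulA _ _ _ sa rb.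
have -> : gmul (grange b) b = b; last by [].
by rewrite rbE -{1}(ginvK b); apply/gmulKV/composableVl.
Qed.

Lemma composableE a b : composable (a, b) <-> gsource a = grange b.
Proof.
by split; [exact: composable_source_range | exact: source_range_composable].
Qed.

End groupoid_theory.

(* Every [measurableType] is pointed, hence the following copy of [T] with
   distinguished point [x]. The Borel sets of [borel x] do not depend on [x]. *)
Definition pointed_at (T : Type) (x : T) : Type := T.

HB.instance Definition _ (T : topologicalType) (x : T) :=
  Topological.copy (pointed_at x) T.
HB.instance Definition _ (T : topologicalType) (x : T) :=
  isPointed.Build (pointed_at x) x.

Notation borel x := (g_sigma_algebraType (@open (pointed_at x))).

Section radon.
Variables (R : realType) (T : lchType) (x0 : T).

Record radon (mu : {measure set (borel x0) -> \bar R}) : Prop := {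
  radon_fin : forall K : set T, compact K -> (mu K < +oo)%E;
  radon_outer : forall A : set (borel x0), measurable A ->
    mu A = ereal_inf [set mu U | U in [set U : set T | open U /\ A `<=` U]];
  radon_inner : forall U : set T, open U ->
    mu U = ereal_sup [set mu K | K in [set K : set T | compact K /\ K `<=` U]]
}.

Definition msupport (mu : {measure set (borel x0) -> \bar R}) : set T :=
  [set x | forall U : set T, open U -> U x -> (0 < mu U)%E].

(* The cast gives [R[i]] the topology of its norm. *)
Definition Cc (f : T -> R[i]) : Prop :=
  continuous (f : T -> (R[i] : numFieldType)) /\
  compact (closure [set x | f x != 0]).

Definition cintegral (mu : {measure set (borel x0) -> \bar R}) (D : set T)
    (f : T -> R[i]) : R[i] :=
  (Rintegral mu D (fun x => complex.Re (f x)) +i*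
   Rintegral mu D (fun x => complex.Im (f x)))%C.

End radon.

Record haar_measure (R : realType) (Gamma : lcaGroupType)
    (la : {measure set (borel (0 : Gamma)) -> \bar R}) : Prop := {
  haar_radon : radon la;
  haar_neq0 : la [set: Gamma] != 0%E;
  haar_invariant : forall (a : Gamma) (A : set (borel (0 : Gamma))), measurable A ->
    la [set (a + x : Gamma) | x in A] = la A
}.

(* The family is indexed by the whole groupoid, but only its values at units
   matter. For convenience [nu u] is on the Borel space pointed at [u]. In the invariance, the
   integral on the left is over the range fibre of [gsource a], which is the
   support of the measure and on which [gmul a] is meaningful. *)
Record haar_system (R : realType) (H : lchGroupoidType)
    (nu : forall u : H, {measure set (borel u) -> \bar R}) : Prop := {
  hs_radon : forall u, units u -> radon (nu u);
  hs_support : forall u, units u -> msupport (nu u) = rfibre u;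
  hs_continuous : forall f : H -> R[i], Cc f ->
    {within @units H, continuous
      (fun u => cintegral (nu u) setT f : (R[i] : numFieldType))};
  hs_invariant : forall (a : H) (f : H -> R[i]), Cc f ->
    cintegral (nu (gsource a)) (rfibre (gsource a)) (fun b => f (gmul a b)) =
    cintegral (nu (grange a)) setT f
}.

Section topological_maps.
Variables X Y : topologicalType.

(* [f], restricted to [A], is a homeomorphism onto [f @` A], for the subspace
   topologies. *)
Definition embedding_on (A : set X) (f : X -> Y) : Prop :=
  [/\ {within A, continuous f}, set_inj A f &
      forall U, open U ->
        exists2 V, open V & f @` (A `&` U) = f @` A `&` V].

Definition homeo_on (A : set X) (B : set Y) (f : X -> Y) : Prop :=
  embedding_on A f /\ f @` A = B.

Definition quotient_map (f : X -> Y) : Prop :=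
  set_surj setT setT f /\ forall V, open (f @^-1` V) <-> open V.

End topological_maps.

Definition groupoid_morphism (G H : groupoidType) (f : G -> H) : Prop :=
  forall a b, composable (a, b) ->
    composable (f a, f b) /\ f (gmul a b) = gmul (f a) (f b).

(* [iota] is only meaningful on [units `*` setT], the trivial bundle of groups
   with fibre [Gamma]. A unit [u] of [Sigma] is identified with the unit [pi u]
   of [G], so that "iota (r sigma, alpha)" reads
   [iota (pi (grange x), alpha)]. *)
Record twist (Gamma : lcaGroupType) (G Sigma : lchGroupoidType)
    (iota : G * Gamma -> Sigma) (pi : Sigma -> G) : Prop := {
  twist_units : @units Sigma = iota @` (@units G `*` [set 0]);
  twist_iota_morphism : forall (u : G) (al be : Gamma), units u ->
    composable (iota (u, al), iota (u, be)) /\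
    iota (u, al + be) = gmul (iota (u, al)) (iota (u, be));
  twist_iota_embedding : embedding_on (@units G `*` [set: Gamma]) iota;
  twist_iota_units : homeo_on (@units G `*` [set 0]) (@units Sigma) iota;
  twist_pi_morphism : groupoid_morphism pi;
  twist_pi_continuous : continuous pi;
  twist_pi_quotient : quotient_map pi;
  twist_pi_units : homeo_on (@units Sigma) (@units G) pi;
  twist_exact : iota @` (@units G `*` [set: Gamma]) = pi @^-1` (@units G);
  twist_central : forall (x : Sigma) (al : Gamma),
    [/\ composable (iota (pi (grange x), al), x),
        composable (x, iota (pi (gsource x), al)) &
        gmul (iota (pi (grange x), al)) x = gmul x (iota (pi (gsource x), al))]
}.

Definition twist_act (Gamma : lcaGroupType) (G Sigma : lchGroupoidType)
    (iota : G * Gamma -> Sigma) (pi : Sigma -> G) (al : Gamma) (x : Sigma) :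
    Sigma :=
  gmul (iota (pi (grange x), al)) x.

(* Main.v *)
(* Translating by the action of Gamma, Haar invariance makes the fibre integral
   x |-> \int f(al . x) d la(al) constant on the fibres of pi. It is continuous
   because only a compact set of al contributes for x in a compact set, so it
   descends to f_G in C_c(G), and mu^(u)(f) = lam^(pi u)(f_G). Every property of
   mu is then read off lam: continuity directly, the support by testing against
   bump functions, and invariance because f(a .) descends to f_G(pi(a) .) on the
   range fibre of s(a). *)

(* The measures [mu u] are known only through integrals of functions in [Cc], and the spaces carry
   no countability assumption, so every claim is put in terms of such functions and of regularity by
   compact sets. Three obstacles shape the proof. The section may be discontinuous, so f_G is seen
   to be continuous only through the quotient map [pi]. Multiplication is total but continuous only
   on composable pairs, so a left translate of a function in [Cc] has to be corrected off one range
   fibre, which calls for a Tietze theorem with compact supports. Finally [Cc] consists of complex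
   functions while positivity arguments want real ones: the work is done for real functions and
   transferred through real and imaginary parts. *)
Require Import Defs.
From HB Require Import structures.
From mathcomp Require Import all_boot all_order all_algebra.
From mathcomp Require Import complex.
From mathcomp Require Import all_classical all_reals all_analysis.
From mathcomp Require Import measurable_realfun.

Set Implicit Arguments.
Unset Strict Implicit.
Unset Printing Implicit Defensive.

Import Order.TTheory GRing.Theory Num.Theory.
Import numFieldNormedType.Exports.

Local Open Scope classical_set_scope.
Local Open Scope ring_scope.

(** * Groupoid identities and morphisms *)

Section groupoid_algebra.
Variable G : groupoidType.
Implicit Types a b u : G.

Lemma gmulK a : gmul (grange a) a = a.
Proof. by have := gmulVK _ _ (composableV a); rewrite ginvK. Qed.

Lemma gmulS a : gmul a (gsource a) = a.
Proof. by have := gmulKV _ _ (composableVl a); rewrite ginvK. Qed.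

Lemma grangeV a : grange (ginv a) = gsource a.
Proof. by rewrite /grange ginvK. Qed.

Lemma gsourceV a : gsource (ginv a) = grange a.
Proof. by rewrite /gsource ginvK. Qed.

Lemma composable_range a : composable (grange a, a).
Proof. by have [] := gmulA _ _ _ (composableV a) (composableVl a). Qed.

Lemma composable_source a : composable (a, gsource a).
Proof. by have [] := gmulA _ _ _ (composableV a) (composableVl a). Qed.

Lemma gsource_range a : gsource (grange a) = grange a.
Proof. by apply/composableE/composable_range. Qed.

Lemma grangeM a b : composable (a, b) -> grange (gmul a b) = grange a.
Proof.
move=> ab; have [_ /composableE <- _] := gmulA _ _ _ (composable_range a) ab.
exact: gsource_range.
Qed.

Lemma grange_range a : grange (grange a) = grange a.
Proof. exact: grangeM (composableV a). Qed.

Lemma grange_source a : grange (gsource a) = gsource a.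
Proof. by rewrite -(grangeV a) grange_range. Qed.

Lemma gsourceM a b : composable (a, b) -> gsource (gmul a b) = gsource b.
Proof.
move=> ab; have [c1 c2 _] := gmulA _ _ _ ab (composable_source b).
by rewrite (composable_source_range c1) grange_source.
Qed.

Lemma units_range a : units (grange a).
Proof. by exists a. Qed.

Lemma units_source a : units (gsource a).
Proof. by rewrite -grangeV; exact: units_range. Qed.

Lemma grange_unit u : units u -> grange u = u.
Proof. by move=> [a _ <-]; rewrite grange_range. Qed.

Lemma gsource_unit u : units u -> gsource u = u.
Proof. by move=> [a _ <-]; rewrite gsource_range. Qed.

Lemma unitsE : @units G = [set u | grange u = u].
Proof.
apply/seteqP; split=> u; first exact: grange_unit.
by move=> /= <-; exact: units_range.
Qed.

Lemma gmulAE a b c : gsource a = grange b -> gsource b = grange c ->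
  gmul (gmul a b) c = gmul a (gmul b c).
Proof.
move=> /source_range_composable ab /source_range_composable bc.
by have [] := gmulA _ _ _ ab bc.
Qed.

Lemma gmulKE a b : gsource a = grange b -> gmul (ginv a) (gmul a b) = b.
Proof. by move=> /source_range_composable/gmulKV. Qed.

Lemma gmulVKE a b : gsource a = gsource b -> gmul (gmul a (ginv b)) b = a.
Proof.
by rewrite -(grangeV b) => /source_range_composable/gmulVK; rewrite ginvK.
Qed.

End groupoid_algebra.

Section groupoid_morphisms.
Variables (G H : groupoidType) (f : G -> H).
Hypothesis fM : groupoid_morphism f.

(** A morphism is only assumed to respect products. Cancelling f(a) on the right in f(r(a)) f(a) =
    f(a) shows that f(r(a)) = r(f(a)), and inverses follow. *)
Lemma morphismV a : f (ginv a) = ginv (f a).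
Proof.
have [c1 m1] := fM (composableV a); have [c2 m2] := fM (composableVl a).
have := gmulKV _ _ c1; rewrite -m1.
have [d1 e1] := fM (composable_range a); rewrite gmulK in e1.
have E : gmul (f (grange a)) (f a) = f a by rewrite -e1.
have : f (grange a) = grange (f a).
  by have := gmulVK _ _ d1; rewrite E => <-.
by move=> ->; rewrite -(gsourceV (f a)) gmulS => <-.
Qed.

Lemma morphism_range a : f (grange a) = grange (f a).
Proof. by have [_] := fM (composableV a); rewrite morphismV. Qed.

Lemma morphism_source a : f (gsource a) = gsource (f a).
Proof. by rewrite -!grangeV morphism_range morphismV. Qed.

Lemma morphismM a b : gsource a = grange b -> f (gmul a b) = gmul (f a) (f b).
Proof. by move=> /source_range_composable/fM[]. Qed.

Lemma morphism_units u : units u -> units (f u).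
Proof. by move=> [a _ <-]; rewrite morphism_range; exact: units_range. Qed.

End groupoid_morphisms.

(** * Partial continuity, closed sets and compact sets *)

Lemma continuous_comp_within (X Y Z : topologicalType) (A : set Y)
    (f : X -> Y) (g : Y -> Z) :
  continuous f -> (forall x, A (f x)) -> {within A, continuous g} ->
  continuous (g \o f).
Proof.
move=> cf fA /subspace_continuousP cg x.
apply: cvg_comp (cg _ (fA x)).
move=> U /cf; rewrite /nbhs /=; apply: filterS => y /=; apply; exact: fA.
Qed.

Lemma continuous_pair (X Y Z : topologicalType) (f : X -> Y) (g : X -> Z) :
  continuous f -> continuous g -> continuous (fun x => (f x, g x)).
Proof. by move=> cf cg x; apply: cvg_pair; [exact: cf|exact: cg]. Qed.

Lemma closed_eqfun (X Y : topologicalType) (f g : X -> Y) :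
  hausdorff_space Y -> continuous f -> continuous g ->
  closed [set x | f x = g x].
Proof.
move=> hY cf cg x xcl; apply: hY => U V Uf Vg.
have Ux : nbhs x (f @^-1` U) by exact: cf.
have Vx : nbhs x (g @^-1` V) by exact: cg.
have [y /= [e [Uy Vy]]] := xcl _ (filterI Ux Vx).
by exists (f y); split=> //=; rewrite e.
Qed.

(** A cluster point in [P] of the image filter has a preimage in [A]; since [f] is open onto its
    image, that preimage is a cluster point of the original filter. *)
Lemma compact_embedding_preimage (X Y : topologicalType) (A : set X)
    (f : X -> Y) (P : set Y) :
  embedding_on A f -> compact P -> P `<=` f @` A ->
  compact (A `&` f @^-1` P).
Proof.
move=> [_ finj fopen] cP PA F FF FQ.
have FP : F (f @^-1` P) by apply: filterS FQ; exact: subIsetr.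
have [y [Py Fy]] := cP (f @ F) _ FP.
have [x Ax fxy] := PA _ Py; exists x; split.
  by split=> //=; rewrite fxy.
move=> B U FB /= Ux; move: Ux; rewrite nbhsE => -[V [oV Vx] VU].
have [W oW eW] := fopen _ oV.
have : (f @` A `&` W) (f x) by rewrite -eW; exists x.
move=> -[_ Wfx].
have [_ [[z [Bz [Az Pz]] <-] Wz]] : f @` (B `&` (A `&` f @^-1` P)) `&` W !=set0.
  apply: Fy.
    have FBQ : F (B `&` (A `&` f @^-1` P)) by exact: filterI.
    apply: (@filterS _ F _ (B `&` (A `&` f @^-1` P))) => // z ?.
    by exists z.
  by rewrite -fxy; exact: open_nbhs_nbhs.
have : (f @` A `&` W) (f z) by split=> //; exists z.
rewrite -eW => -[z' [Az' Vz'] zz'].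
exists z; split=> //; apply: VU.
by rewrite -(finj _ _ _ _ zz') ?inE.
Qed.

Section lch.
Variable T : lchType.
Implicit Types (x : T) (K A U : set T).

Lemma lch_compact_closed K : compact K -> closed K.
Proof. by apply: compact_closed; exact: lch_hausdorff. Qed.

Lemma lch_compact_nbhs x : exists2 K, nbhs x K & compact K.
Proof.
have [K] := @lch_locally_compact T x I; rewrite withinET => xK [cK _].
by exists K.
Qed.

Lemma closed_subset_compact K A : compact K -> A `<=` K -> compact (closure A).
Proof.
move=> cK AK; apply: (subclosed_compact _ cK); first exact: closed_closure.
have clK : closed K by exact: lch_compact_closed.
rewrite [X in _ `<=` X](closure_id K).1//.
exact: closureS.
Qed.

End lch.

(** * Real functions with compact support *)

Definition rCc (R : realType) (T : topologicalType) (f : T -> R) : Prop :=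
  continuous f /\ compact (closure [set x | f x != 0]).

Section real_Cc.
Variables (R : realType) (T : lchType).
Implicit Types (f : T -> R) (K W A : set T).

Lemma rCcP f : rCc f <->
  continuous f /\ exists2 K, compact K & forall x, ~ K x -> f x = 0.
Proof.
split=> [[cf cK]|[cf [K cK fK]]]; split=> //.
  exists (closure [set x | f x != 0]) => // x /(contra_not (@subset_closure _ _ x)).
  by move=> /= /negP; rewrite negbK => /eqP.
apply: closed_subset_compact cK _ => x /= /eqP fx0.
by apply: contrapT => /fK.
Qed.

(** Tietze's theorem with compact support. The one-point compactification of [T] is compact
    Hausdorff, hence normal; there the function is prolonged by 0 at infinity and off a
    neighbourhood of [K] before it is extended. *)
Lemma rCc_extension A f K W : closed A -> {within A, continuous f} ->
  compact K -> (forall x, A x -> ~ K x -> f x = 0) -> open W -> K `<=` W ->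
  exists g : T -> R, [/\ rCc g, (forall x, A x -> g x = f x) &
    forall x, ~ W x -> g x = 0].
Proof.
move=> cA cf cK fK oW KW.
pose opc := one_point_compactification T.
have hopc : hausdorff_space opc.
  apply: one_point_compactification_hausdorff; first exact: lch_locally_compact.
  exact: lch_hausdorff.
have nopc : normal_space opc.
  exact: compact_normal hopc one_point_compactification_compact.
have clK : closed K by exact: lch_compact_closed.
(* Normality separates [K] from the point at infinity. Forcing the extension to vanish off [W'] then
   gives both a compact support, inside [C], and vanishing off [W]. *)
have [W' [C [oW' cC KW' W'W W'C]]] : exists W' C : set T,
    [/\ open W', compact C, K `<=` W', W' `<=` W & W' `<=` C].
  have cKo : compact (Some @` K : set opc).
    apply: continuous_compact cK; apply: continuous_subspaceT.
    exact: one_point_compactification_some_continuous.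
  have := (@normal_openP R opc).1 nopc (Some @` K) [set None]
    (compact_closed hopc cKo) (compact_closed hopc (@compact_set1 opc None)).
  case; first by apply/seteqP; split => // z [[x _ <-]].
  move=> U [V [oU oV KU NV UV]].
  have [C [cC clC] CV] : nbhs (None : opc) V.
    by apply: open_nbhs_nbhs; split=> //; exact: NV.
  exists (W `&` Some @^-1` U), C; split => //.
  - apply: openI => //; move: oU; apply: (continuousP _).1.
    exact: one_point_compactification_some_continuous.
  - by move=> x Kx; split; [exact: KW|apply: KU; exists x].
  - move=> x [_ Ux]; apply: contrapT => nCx.
    have : (U `&` V) (Some x) by split=> //; apply: CV; left; exists x.
    by rewrite UV.
pose h x := if x \in A then f x else 0.
have hA x : A x -> h x = f x by rewrite /h => /mem_set ->.
have hK x : ~ K x -> h x = 0.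
  by rewrite /h; case: ifPn => // /set_mem Ax nKx; exact: fK.
pose F (z : opc) : R := if z is Some x then h x else 0.
pose B : set opc := [set z | if z is Some x then A x \/ ~ W' x else True].
have cB : closed B.
  rewrite -(setCK B); apply: open_closedC.
  rewrite (_ : ~` B = Some @` (~` A `&` W')).
    apply: one_point_compactification_open_some.
    by apply: openI => //; exact: closed_openC.
  apply/seteqP; split => [[x|] //= /not_orP[nA /contrapT Wx]|_ [x [nA Wx] <-] /=].
    by exists x.
  by apply/not_orP; split=> //; apply.
(* Points of [B] in [W'] belong to [A], so near a point of [K] the function is [f] on [A]; near any
   other point, infinity included, it is 0. *)
have cF : {within B, continuous F}.
  apply/subspace_continuousP => -[x|] Bz N FN.
  - have [Kx|nKx] := pselect (K x).
      have Ax : A x by case: Bz => // /(_ (KW' _ Kx)).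
      have Nfx : nbhs (f x) N by rewrite -(hA x Ax).
      have fN : nbhs x [set y | A y -> N (f y)].
        by move/subspace_continuousP : cf => /(_ _ Ax N Nfx).
      have W'x : nbhs x W' by apply: open_nbhs_nbhs; split => //; exact: KW'.
      apply: filterS (filterI W'x fN) => y [/= W'y fy] By.
      have Ay : A y by case: By.
      by change (N (h y)); rewrite hA//; exact: fy.
    have nKx' : nbhs x (~` K).
      by apply: open_nbhs_nbhs; split => //; exact: closed_openC.
    apply: filterS nKx' => y nKy _; change (N (h y)); rewrite hK//.
    by rewrite -(hK x nKx); exact: nbhs_singleton FN.
  - exists K; first by split.
    move=> _ [[x nKx <-]|->] _; last exact: nbhs_singleton FN.
    by change (N (h x)); rewrite hK//; exact: nbhs_singleton FN.
have [M M0 FM] : exists2 M : R, 0 < M & forall z, B z -> `|F z| <= M.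
  have : compact (f @` (K `&` A)).
    apply: continuous_compact; last exact: compact_closedI.
    exact: continuous_subspaceW cf.
  move=> /compact_bounded [M [_ MP]].
  (* [compact_bounded] bounds by every number above [M], whence [M + 1]; the 1 makes the bound
     positive. *)
  exists (Num.max 1 (M + 1)); first by rewrite lt_max ltr01.
  move=> [x|] _ /=; last by rewrite normr0 le_max ler01.
  have [Kx|/hK ->] := pselect (K x); last by rewrite normr0 le_max ler01.
  rewrite /h; case: ifPn => [/set_mem Ax|_]; last by rewrite normr0 le_max ler01.
  rewrite le_max; apply/orP; right; apply: (MP (M + 1)); first by rewrite ltrDl.
  by exists x.
have [g [Fg cg _]] := @continuous_bounded_extension opc R nopc B cB F M M0 cF FM.
have gW' x : ~ W' x -> g (Some x) = 0.
  move=> nWx; rewrite -Fg ?inE /=; last by right.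
  by rewrite hK// => /KW'.
exists (g \o Some); split.
- apply/rCcP; split.
    move=> x; apply: continuous_comp; last exact: cg.
    exact: one_point_compactification_some_continuous.
  by exists C => // x nCx; apply: gW' => /W'C.
- by move=> x Ax /=; rewrite -Fg ?inE/= ?hA//; left.
- by move=> x nWx; apply: gW' => /W'W.
Qed.

(** Extends the constant 1 from the closed set of the single point [x]. The extension may change
    sign, hence the absolute value. *)
Lemma rCc_bump x W : open W -> W x -> exists g : T -> R,
  [/\ rCc g, g x = 1, (forall y, 0 <= g y) & forall y, ~ W y -> g y = 0].
Proof.
move=> oW Wx.
have [g [/rCcP[cg [K cK gK]] gx gW]] : exists g : T -> R, [/\ rCc g,
    (forall y, [set x] y -> g y = cst 1 y) & forall y, ~ W y -> g y = 0].
  apply: (@rCc_extension _ _ [set x]) => //.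
  - by apply: lch_compact_closed; exact: compact_set1.
  - exact: continuous_subspace1.
  - exact: compact_set1.
  - by move=> y ->.
exists (fun y => `|g y|); split.
- apply/rCcP; split; last by exists K => // y /gK ->; rewrite normr0.
  by move=> y; apply: cvg_norm; exact: cg.
- by rewrite gx// normr1.
- by move=> y; exact: normr_ge0.
- by move=> y /gW ->; rewrite normr0.
Qed.

Lemma rCc_bounded f : rCc f -> exists M : R, forall x, `|f x| <= M.
Proof.
move=> /rCcP[cf [K cK fK]].
have : compact (f @` K).
  by apply: continuous_compact => //; exact: continuous_subspaceT.
move=> /compact_bounded [M [_ MP]].
exists (Num.max 0 (M + 1)) => x.
have [Kx|/fK ->] := pselect (K x); last by rewrite normr0 le_max lexx.
rewrite le_max; apply/orP; right; apply: (MP (M + 1)); first by rewrite ltrDl.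
by exists x.
Qed.

End real_Cc.

(** * Radon measures: integrability and supports *)

Section borel_measures.
Variables (R : realType) (T : lchType) (x0 : T).
Implicit Types (mu : {measure set (borel x0) -> \bar R}) (f : T -> R).

Lemma open_borel (U : set T) : open U -> measurable (U : set (borel x0)).
Proof. by move=> oU; exact: sub_sigma_algebra. Qed.

Lemma closed_borel (A : set T) : closed A -> measurable (A : set (borel x0)).
Proof.
move=> cA; rewrite -(setCK A); apply: measurableC; apply: open_borel.
exact: closed_openC.
Qed.

Lemma compact_borel (A : set T) : compact A -> measurable (A : set (borel x0)).
Proof. by move=> cA; apply: closed_borel; exact: lch_compact_closed. Qed.

Lemma continuous_borel (D : set T) f : continuous f ->
  measurable_fun (D : set (borel x0)) f.
Proof.
move=> /continuousP cf; apply: (@measurable_funS _ _ _ _ setT) => //.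
apply: (measurability _ (RGenOpens.measurableE R)).
move=> _ [_ [a [b ->] <-]]; rewrite setTI; apply: open_borel.
exact/cf/interval_open.
Qed.

Lemma compact_indic_integrable mu (K : set T) : radon mu -> compact K ->
  mu.-integrable setT (fun x : borel x0 => (\1_K x)%:E).
Proof.
move=> rmu cK; have mK := compact_borel cK; apply/integrableP; split.
  by apply/measurable_EFinP; exact: measurable_indic.
rewrite (eq_integral (fun x : borel x0 => (\1_K x)%:E)); last first.
  by move=> t _; rewrite /= ger0_norm.
rewrite integral_indic// setIT; exact: radon_fin.
Qed.

(** A multiple of the indicator of a compact set dominates [f], and Radon measures are finite on
    compact sets. *)
Lemma rCc_integrable mu f : radon mu -> rCc f ->
  mu.-integrable setT (EFin \o f).
Proof.
move=> rmu Cf; have [M fM] := rCc_bounded Cf.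
have /rCcP[cf [K cK fK]] := Cf.
apply: (@le_integrable _ _ _ _ _ measurableT _
    (fun x : borel x0 => (M%:E * (\1_K x)%:E)%E)).
- by apply/measurable_EFinP; exact: continuous_borel.
- move=> x _ /=; rewrite lee_fin.
  have [Kx|nKx] := pselect (K x).
    by rewrite indicE mem_set// mulr1 (le_trans (fM x))// ler_norm.
  by rewrite fK// normr0.
- apply: integrableZl => //; exact: compact_indic_integrable.
Qed.

(** [T] need not be second countable, so a countable subcover may fail to exist. Inner regularity
    reduces the claim to compact subsets of [U], which finitely many of the null open sets cover. *)
Lemma radon_open0 mu (U : set T) : radon mu -> open U ->
  (forall x, U x -> exists V : set T, [/\ open V, V x & mu V = 0%E]) -> mu U = 0%E.
Proof.
move=> rmu oU Unull; apply/eqP; rewrite eq_le measure_ge0 andbT.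
rewrite (radon_inner rmu oU); apply: ub_ereal_sup => _ [K [cK KU] <-].
suff K0 : mu.-negligible (K : set (borel x0)).
  have mK : measurable (K : set (borel x0)) by exact: compact_borel.
  by rewrite (measure_negligible mK K0).
have /choice[V VP] : forall x, exists V : set T,
    [/\ open V, U x -> V x & mu V = 0%E].
  move=> x; have [/Unull[V [? ? ?]]|nU] := pselect (U x); first by exists V.
  by exists set0; split=> //; exact: open0.
have cK' : @cover_compact (pointed_at x0) K by rewrite -compact_cover.
have := cK' T setT V.
case=> [x _|x Kx|D _ KD].
- by have [] := VP x.
- by exists x => //; have [_ + _] := VP x; apply; exact: KU.
apply: (@negligibleS _ (borel x0) _ mu _ _ KD); rewrite /cover bigcup_fset.
apply: (@big_ind _ (fun A : set (borel x0) => mu.-negligible A)) => [||x _].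
- exact: negligible_set0.
- by move=> A B; exact: negligibleU.
have [oV _ V0] := VP x.
by exists (V x); split => //; exact: open_borel.
Qed.

Lemma closed_msupport mu : closed (msupport mu).
Proof.
move=> x xcl U oU Ux; have [y [ys Uy]] := xcl U (open_nbhs_nbhs (conj oU Ux)).
exact: ys.
Qed.

Lemma radon_supportC mu : radon mu -> mu (~` msupport mu) = 0%E.
Proof.
move=> rmu; apply: radon_open0 => //.
  exact/closed_openC/closed_msupport.
move=> x /existsNP[U] /not_implyP[oU] /not_implyP[Ux] /negP.
by rewrite lt0e measure_ge0 andbT negbK => /eqP U0; exists U.
Qed.

(** In a Haar system the support is a range fibre, so this converts integrals over the whole
    groupoid into integrals over a fibre and back. *)
Lemma rCc_Rintegral_support mu f : radon mu -> rCc f ->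
  Rintegral mu setT f = Rintegral mu (msupport mu) f.
Proof.
move=> rmu Cf; rewrite /Rintegral.
rewrite (@negligible_integral _ _ _ mu setT (~` msupport mu))//.
- by rewrite setTD setCK.
- apply: open_borel; exact/closed_openC/closed_msupport.
- exact: rCc_integrable.
- exact: radon_supportC.
Qed.

(** The set [U] where [f] exceeds half of f(x) is an open neighbourhood of a point of the support,
    so it has positive measure. A zero integral would make [f] vanish almost everywhere and [U]
    null. *)
Lemma rCc_Rintegral_gt0 mu f (x : T) : radon mu -> rCc f ->
  (forall y, 0 <= f y) -> msupport mu x -> 0 < f x ->
  0 < Rintegral mu setT f.
Proof.
move=> rmu Cf f0 mux fx.
have intf := rCc_integrable rmu Cf.
have [cf _] := Cf.
pose U := f @^-1` `]f x / 2, +oo[%classic.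
have oU : open U by move/continuousP : cf; apply; exact: rray_open.
have Ux : U x by rewrite /U /= in_itv /= andbT ltr_pdivrMr// ltr_pMr// ltr1n.
have muU := mux _ oU Ux.
rewrite lt_neqAle Rintegral_ge0 ?andbT//; apply/negP => /eqP int0.
have : (\int[mu]_y `|(f y)%:E| = 0)%E.
  under eq_integral => y _ do rewrite gee0_abs ?lee_fin//.
  by rewrite -[LHS]fineK ?integrable_fin_num//; congr EFin.
have mf := measurable_int _ intf.
move=> /(ae_eq_integral_abs mu measurableT mf)[N [mN N0 sub]].
have UN : U `<=` N.
  move=> y Uy; apply: sub => /= /(_ Logic.I)[fy0].
  by move: Uy; rewrite /U /= in_itv /= andbT fy0 ltNge divr_ge0// ltW.
have mU : measurable (U : set (borel x0)) by exact: open_borel.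
by move: muU; rewrite (subset_measure0 mU mN UN)// ltxx.
Qed.


End borel_measures.

(** * Translation invariance and full support of Haar measure *)

Section haar_integral.
Variables (R : realType) (Gamma : lcaGroupType).
Variable la : {measure set (borel (0 : Gamma)) -> \bar R}.
Hypothesis Hla : haar_measure la.

Lemma translation_continuous (a : Gamma) : continuous (fun x : Gamma => a + x).
Proof.
move=> x; apply: (@continuous_comp _ _ _ (fun x => (a, x))
  (fun z : Gamma * Gamma => z.1 + z.2)).
  by apply: cvg_pair; [exact: cvg_cst|exact: cvg_id].
exact: add_continuous.
Qed.

Lemma translation_preimage (a : Gamma) (A : set Gamma) :
  (fun x => a + x) @^-1` A = [set - a + x | x in A].
Proof.
apply/seteqP; split => [x Ax|_ [y Ay <-]] /=; last by rewrite addrA subrr add0r.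
by exists (a + x) => //; rewrite addrA addNr add0r.
Qed.

Lemma rCc_translation (f : Gamma -> R) (a : Gamma) : rCc f ->
  rCc (fun x => f (a + x)).
Proof.
move=> /rCcP[cf [K cK fK]]; apply/rCcP; split.
  move=> x; apply: (@continuous_comp _ _ _ (fun x => a + x)); last exact: cf.
  exact: translation_continuous.
exists [set - a + x | x in K].
  apply: continuous_compact cK; apply: continuous_subspaceT.
  exact: translation_continuous.
by move=> x; rewrite -translation_preimage; exact: fK.
Qed.

(** The push-forward of [la] along translation by [a] assigns to [A] the measure of the translate of
    [A] by [- a], so it is [la] again. *)
Lemma haar_Rintegral_translation (f : Gamma -> R) (a : Gamma) : rCc f ->
  Rintegral la setT (fun x => f (a + x)) = Rintegral la setT f.
Proof.
move=> Cf; pose phi (x : borel (0 : Gamma)) : borel (0 : Gamma) := a + x.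
have mphi : measurable_fun setT phi.
  apply: (@measurability _ _ _ _ setT phi
    (@open (pointed_at (0 : Gamma)))) => // _ [U oU <-]; rewrite setTI.
  apply: open_borel; move: oU; apply: (continuousP _).1.
  exact: translation_continuous.
have mf : measurable_fun setT (EFin \o (f : borel (0 : Gamma) -> R)).
  by apply/measurable_EFinP; apply: continuous_borel; case: Cf.
have intf : la.-integrable (phi @^-1` setT) ((EFin \o f) \o phi).
  exact: rCc_integrable (haar_radon Hla) (rCc_translation a Cf).
rewrite /Rintegral; congr fine.
have := integral_pushforward mphi mf intf measurableT.
rewrite preimage_setT => <-; apply: eq_measure_integral => A mA _.
rewrite /= /pushforward translation_preimage.
exact: haar_invariant.
Qed.

(** A null open neighbourhood of one point can be translated to every point; [radon_open0] would
    then make [la] zero. *)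
Lemma haar_msupport : msupport la = setT.
Proof.
apply/seteqP; split=> // x _ U oU Ux; rewrite lt0e measure_ge0 andbT.
apply/negP => /eqP U0; move: (haar_neq0 Hla) => /negP; apply; apply/eqP.
apply: (radon_open0 (haar_radon Hla)); first exact: openT.
move=> y _; exists ((fun z => (x - y) + z) @^-1` U); split.
- move: oU; apply: (continuousP _).1; exact: translation_continuous.
- by rewrite /= subrK.
- rewrite translation_preimage -[RHS]U0; apply: (haar_invariant Hla).
  exact: open_borel.
Qed.

End haar_integral.

(** * Topology of a groupoid *)

Section groupoid_topology.
Variable G : lchGroupoidType.

Lemma grange_continuous : continuous (@grange G).
Proof.
apply: (@continuous_comp_within _ _ _ (@composable G) (fun a : G => (a, ginv a))
  (fun p => gmul p.1 p.2)).
- by apply: continuous_pair; [move=> x; exact: cvg_id|exact: ginv_continuous].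
- by move=> a; exact: composableV.
- exact: gmul_continuous.
Qed.

Lemma gsource_continuous : continuous (@gsource G).
Proof.
apply: (@continuous_comp_within _ _ _ (@composable G) (fun a : G => (ginv a, a))
  (fun p => gmul p.1 p.2)).
- by apply: continuous_pair; [exact: ginv_continuous|move=> x; exact: cvg_id].
- by move=> a; exact: composableVl.
- exact: gmul_continuous.
Qed.

Lemma closed_units : closed (@units G).
Proof.
rewrite unitsE; apply: closed_eqfun; first exact: lch_hausdorff.
- exact: grange_continuous.
- by move=> x; exact: cvg_id.
Qed.

Lemma closed_rfibre (u : G) : closed (rfibre u).
Proof.
apply: closed_eqfun; first exact: lch_hausdorff.
- exact: grange_continuous.
- exact: cst_continuous.
Qed.

Lemma gmull_continuous (a : G) :
  {within rfibre (gsource a), continuous (gmul a)}.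
Proof.
apply/subspace_continuousP => b /= ab N /=.
have cab : composable (a, b) by exact: source_range_composable.
move/subspace_continuousP : (@gmul_continuous G) => /(_ (a, b) cab N) /[apply].
case=> -[U V] /= [Ua Vb] UV; rewrite /nbhs /=.
apply: filterS Vb => c Vc ac.
apply: (UV (a, c)); first by split=> //=; exact: nbhs_singleton.
exact: source_range_composable.
Qed.

End groupoid_topology.

(** * The action of [Gamma] on a twist *)

Section twist_theory.
Variables (Gamma : lcaGroupType) (G Sigma : lchGroupoidType).
Variables (iota : G * Gamma -> Sigma) (pi : Sigma -> G).
Hypothesis tw : twist iota pi.
Local Notation act := (twist_act iota pi).
Let piM := twist_pi_morphism tw.
Implicit Types (x y : Sigma) (al be : Gamma).

Lemma twist_unit_inj x y : units x -> units y -> pi x = pi y -> x = y.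
Proof.
have [[_ inj _] _] := twist_pi_units tw.
by move=> ux uy; apply: inj; rewrite inE.
Qed.

Lemma twist_unit_lift v : units v -> exists2 x, units x & pi x = v.
Proof.
by have [_ <-] := twist_pi_units tw => -[x ux <-]; exists x.
Qed.

Lemma twist_iota_source x al : gsource (iota (pi (grange x), al)) = grange x.
Proof. by have [/composableE] := twist_central tw x al. Qed.

(** By exactness pi(iota(v, al)) is a unit, so it equals its source. That source is the image of the
    source of iota(v, al), which the composability in [twist_central] identifies with the unit over
    [v]. *)
Lemma twist_pi_iota v al : units v -> pi (iota (v, al)) = v.
Proof.
move=> uv; have [x ux xv] := twist_unit_lift uv.
have : (pi @^-1` (@units G)) (iota (v, al)).
  by rewrite -(twist_exact tw); exists (v, al).
move=> /= /gsource_unit <-; rewrite -(morphism_source piM).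
by rewrite -xv -{1}(grange_unit ux) twist_iota_source grange_unit.
Qed.

Lemma twist_iota_range x al : grange (iota (pi (grange x), al)) = grange x.
Proof.
apply: twist_unit_inj; [exact: units_range..|].
have upi : units (pi (grange x)).
  by apply: (morphism_units piM); exact: units_range.
by rewrite (morphism_range piM) twist_pi_iota// grange_unit.
Qed.

Lemma twist_act_range x al : grange (act al x) = grange x.
Proof.
by have [c _ _] := twist_central tw x al; rewrite grangeM// twist_iota_range.
Qed.

Lemma twist_act_source x al : gsource (act al x) = gsource x.
Proof. by have [c _ _] := twist_central tw x al; rewrite gsourceM. Qed.

Lemma twist_pi_act x al : pi (act al x) = pi x.
Proof.
rewrite (morphismM piM) ?twist_iota_source// twist_pi_iota.
  by rewrite (morphism_range piM) gmulK.
by apply: (morphism_units piM); exact: units_range.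
Qed.

Lemma twist_actD x al be : act (al + be) x = act al (act be x).
Proof.
have upi : units (pi (grange x)).
  by apply: (morphism_units piM); exact: units_range.
have [_ e] := twist_iota_morphism tw al be upi.
rewrite /twist_act e -/(twist_act iota pi be x) twist_act_range gmulAE//.
- by rewrite twist_iota_source twist_iota_range.
- by rewrite twist_iota_source.
Qed.

Lemma twist_act0 x : act 0 x = x.
Proof.
have ui : units (iota (pi (grange x), 0)).
  rewrite (twist_units tw); exists (pi (grange x), 0) => //; split => //=.
  by apply: (morphism_units piM); exact: units_range.
by rewrite /twist_act -(gsource_unit ui) twist_iota_source gmulK.
Qed.

(** Centrality carries the factor given by [iota] from the source of [a] to its range. The
    invariance of [mu] rests on this. *)
Lemma twist_act_mul a x al : gsource a = grange x ->
  gmul a (act al x) = act al (gmul a x).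
Proof.
move=> ax; have [_ c e] := twist_central tw a al.
have ra : grange (gmul a x) = grange a.
  by rewrite grangeM//; exact: source_range_composable.
rewrite /twist_act ra -gmulAE ?twist_iota_range ?twist_iota_source//.
by rewrite -ax -e gmulAE// twist_iota_source.
Qed.

(** The product of [x] with the inverse of [y] lies over a unit, so by exactness it is in the image
    of [iota]; comparing sources gives its base point. *)
Lemma twist_act_transitive x y : pi x = pi y -> exists al, x = act al y.
Proof.
move=> xy; have sxy : gsource x = gsource y.
  apply: twist_unit_inj; [exact: units_source..|].
  by rewrite !(morphism_source piM) xy.
have cxy : composable (x, ginv y).
  by apply: source_range_composable; rewrite grangeV.
have : (pi @^-1` (@units G)) (gmul x (ginv y)).
  rewrite /= (piM cxy).2 (morphismV piM) xy; exact: units_range.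
rewrite -(twist_exact tw) => -[[v al] [/= uv _] e]; exists al.
have ev : v = pi (grange y).
  have : gsource (pi (iota (v, al))) = v by rewrite twist_pi_iota// gsource_unit.
  by rewrite -(morphism_source piM) e gsourceM// gsourceV.
by rewrite /twist_act -ev e gmulVKE.
Qed.

Lemma twist_act_continuous : continuous (fun p : Gamma * Sigma => act p.1 p.2).
Proof.
apply: (@continuous_comp_within _ _ _ (@composable Sigma)
  (fun p : Gamma * Sigma => (iota (pi (grange p.2), p.1), p.2))
  (fun p => gmul p.1 p.2)); last exact: gmul_continuous.
- apply: continuous_pair; last by move=> p; exact: cvg_snd.
  apply: (@continuous_comp_within _ _ _ (@units G `*` setT)
    (fun p : Gamma * Sigma => (pi (grange p.2), p.1)) iota).
  + apply: continuous_pair; last by move=> p; exact: cvg_fst.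
    move=> p; apply: (@continuous_comp _ _ _ snd (pi \o @grange Sigma)).
      exact: cvg_snd.
    apply: continuous_comp; first exact: grange_continuous.
    exact: twist_pi_continuous tw _.
  + move=> p; split => //=; apply: (morphism_units piM); exact: units_range.
  + by have [] := twist_iota_embedding tw.
- by move=> p; have [] := twist_central tw p.2 p.1.
Qed.

(* The [al] with [act al x \in S] for some [x \in N] are recovered, through the
   embedding [iota], from the products [s * x^-1] with [s \in S], [x \in N]. *)
Lemma twist_act_proper (S N : set Sigma) : compact S -> compact N ->
  exists2 K : set Gamma, compact K & forall al x, N x -> S (act al x) -> K al.
Proof.
move=> cS cN.
pose C := (S `*` N) `&` [set p | gsource p.1 = gsource p.2].
have cC : compact C.
  apply: compact_closedI; first exact: compact_setX.
  apply: closed_eqfun; first exact: lch_hausdorff.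
  - move=> p; apply: (@continuous_comp _ _ _ fst (@gsource Sigma)).
      exact: cvg_fst.
    exact: gsource_continuous.
  - move=> p; apply: (@continuous_comp _ _ _ snd (@gsource Sigma)).
      exact: cvg_snd.
    exact: gsource_continuous.
pose q (p : Sigma * Sigma) := gmul p.1 (ginv p.2).
have cq : {within C, continuous q}.
  apply/subspace_continuousP => p [_ /= e] U.
  have cp : composable (p.1, ginv p.2).
    by apply: source_range_composable; rewrite grangeV.
  move/subspace_continuousP : (@gmul_continuous Sigma) => /(_ _ cp U) /[apply].
  have : {for p, continuous (fun p : Sigma * Sigma => (p.1, ginv p.2))}.
    apply: continuous_pair; first by move=> z; exact: cvg_fst.
    move=> z; apply: (@continuous_comp _ _ _ snd (@ginv Sigma)).
      exact: cvg_snd.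
    exact: ginv_continuous.
  move=> /[apply]; rewrite /nbhs /=; apply: filterS => z /= zU [_ /= ez].
  by apply: zU; apply: source_range_composable; rewrite grangeV.
(* Products over a non-unit are discarded, so that [P] lies in the image of [iota] and pulls back to
   a compact set. *)
pose P := (q @` C) `&` pi @^-1` (@units G).
have cP : compact P.
  apply: compact_closedI; first exact: continuous_compact.
  apply: (continuous_closedP pi).1; last exact: closed_units.
  exact: twist_pi_continuous tw.
pose A := (@units G `*` [set: Gamma]) `&` iota @^-1` P.
have cA : compact A.
  apply: compact_embedding_preimage => //; first exact: (twist_iota_embedding tw).
  by rewrite (twist_exact tw) => x [].
exists (snd @` A).
  apply: continuous_compact cA; apply: continuous_subspaceT => p.
  exact: cvg_snd.
move=> al x Nx Sx; exists (pi (grange x), al) => //; split=> /=.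
  by split=> //=; apply: (morphism_units piM); exact: units_range.
split=> /=; last first.
  by rewrite twist_pi_iota; apply: (morphism_units piM); exact: units_range.
exists (act al x, x).
  by split=> //=; rewrite twist_act_source.
have [c _ _] := twist_central tw x al.
by rewrite /q /= gmulVK.
Qed.

(** * Integration along the fibres of [pi] *)

Section fibre_integral.
Variables (R : realType) (la : {measure set (borel (0 : Gamma)) -> \bar R}).
Hypothesis Hla : haar_measure la.

Definition fibre_integral (f : Sigma -> R) (x : Sigma) : R :=
  Rintegral la setT (fun al => f (act al x)).

Lemma rCc_fibre (f : Sigma -> R) x : rCc f -> rCc (fun al => f (act al x)).
Proof.
move=> /rCcP[cf [S cS fS]]; apply/rCcP; split.
  move=> al; apply: (@continuous_comp _ _ _ (act^~ x)); last exact: cf.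
  apply: (@continuous_comp _ _ _ (fun al => (al, x)) (fun p => act p.1 p.2)).
    by apply: cvg_pair; [exact: cvg_id|exact: cvg_cst].
  exact: twist_act_continuous.
have [K cK KP] := twist_act_proper cS (@compact_set1 _ x).
by exists K => // al nK; apply: fS => /(KP _ _ erefl).
Qed.

Lemma fibre_integral_pi (f : Sigma -> R) x y : rCc f -> pi x = pi y ->
  fibre_integral f x = fibre_integral f y.
Proof.
move=> Cf /twist_act_transitive[be ->].
rewrite -[RHS](haar_Rintegral_translation Hla be (rCc_fibre y Cf)).
by apply: eq_Rintegral => al _; rewrite addrC twist_actD.
Qed.

Lemma fibre_integral_continuous (f : Sigma -> R) : rCc f ->
  continuous (fibre_integral f).
Proof.
move=> Cf x0; have /rCcP[cf [S cS fS]] := Cf.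
have [N x0N cN] := lch_compact_nbhs x0.
have [K cK KP] := twist_act_proper cS cN.
have Nx0 : N x0 by exact: nbhs_singleton.
have laK := radon_fin (haar_radon Hla) cK.
have mK : measurable (K : set (borel (0 : Gamma))) by exact: compact_borel.
have intK := compact_indic_integrable (haar_radon Hla) cK.
apply/cvgrPdist_lt => e e0.
(* The two integrals will differ by at most d times the measure of [K]. Adding 1 keeps the
   denominator positive when [K] is null and makes the final bound strict. *)
pose d := e / (fine (la K) + 1).
have K1 : 0 < fine (la K) + 1 by rewrite ltr_wpDl// fine_ge0.
have d0 : 0 < d by rewrite divr_gt0.
(* Tube lemma: joint continuity gives the estimate near each pair (al, x0), and compactness of [K]
   makes it uniform in [al]. *)
have : \forall x \near x0, K `<=` (fun al => `|f (act al x0) - f (act al x)| < d).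
  have ncK := (@compact_near_coveringP _ K).1 cK.
  apply: (ncK _ _ (fun x al => `|f (act al x0) - f (act al x)| < d)) => al Kal.
  pose H (p : Gamma * Sigma) := f (act p.1 x0) - f (act p.1 p.2).
  have cH : continuous H.
    move=> p; apply: cvgB.
      apply: (@continuous_comp _ _ _ fst (fun al => f (act al x0))).
        exact: cvg_fst.
      by have [c _] := rCc_fibre x0 Cf; exact: c.
    apply: (@continuous_comp _ _ _ (fun p => act p.1 p.2) f); last exact: cf.
    exact: twist_act_continuous.
  have /cvgrPdist_lt/(_ d d0) := cH (al, x0).
  by apply: filterS => p; rewrite {1}/H subrr sub0r normrN.
move=> nearK; near=> x.
have Nx : N x by near: x.
have Kx al : K al -> `|f (act al x0) - f (act al x)| < d by move: al; near: x.
have int1 := rCc_integrable (haar_radon Hla) (rCc_fibre x0 Cf).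
have int2 := rCc_integrable (haar_radon Hla) (rCc_fibre x Cf).
have int12 : la.-integrable setT (EFin \o
    (fun al : borel (0 : Gamma) => f (act al x0) - f (act al x))).
  by have := integrableB measurableT int1 int2.
rewrite /fibre_integral -RintegralB//.
apply: (@le_lt_trans _ _ (Rintegral la setT (fun al => d * \1_K al))).
  apply: (le_trans (le_normr_Rintegral measurableT int12)).
  apply: le_Rintegral => //.
  - by have := integrable_abse int12.
  - by have := integrableZl measurableT d intK.
  - move=> al _; rewrite indicE; case: (pselect (K al)) => [Kal|nKal].
      by rewrite mem_set// mulr1; apply: ltW; exact: Kx.
    (* Off [K] both terms vanish, because [x0] and [x] lie in [N]. *)
    have f0 y : N y -> f (act al y) = 0.
      by move=> Ny; apply: fS => Sy; exact: nKal (KP _ _ Ny Sy).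
    by rewrite !f0// subrr normr0 mulr_ge0// ltW.
rewrite RintegralZl//.
rewrite [X in _ * X](_ : _ = fine (la K)); last first.
  by rewrite /Rintegral integral_indic// setIT.
by rewrite /d mulrAC ltr_pdivrMr// ltr_pM2l// ltrDl.
Unshelve. all: by end_near. Qed.

(** The function f_G, computed with an arbitrary section. *)
Definition descent (sec : G -> Sigma) (f : Sigma -> R) (g : G) : R :=
  fibre_integral f (sec g).

Variable sec : G -> Sigma.
Hypothesis secK : forall g, pi (sec g) = g.

Lemma descent_pi (f : Sigma -> R) x : rCc f ->
  descent sec f (pi x) = fibre_integral f x.
Proof. by move=> Cf; apply: fibre_integral_pi => //; rewrite secK. Qed.

(** Since [sec] may be discontinuous, continuity is tested through the quotient map: composed with
    [pi], the descent becomes the continuous fibre integral. It vanishes off the image of a compact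
    set carrying [f], as the action preserves the fibres of [pi]. *)
Lemma rCc_descent (f : Sigma -> R) : rCc f -> rCc (descent sec f).
Proof.
move=> Cf; have /rCcP[_ [S cS fS]] := Cf; apply/rCcP; split.
  apply/continuousP => V oV.
  have [_ quot] := twist_pi_quotient tw; apply/quot.
  rewrite (_ : _ @^-1` _ = fibre_integral f @^-1` V).
    by move/continuousP : (fibre_integral_continuous Cf); apply.
  by apply/seteqP; split=> x /=; rewrite descent_pi.
exists (pi @` S).
  apply: continuous_compact cS; apply: continuous_subspaceT.
  exact: twist_pi_continuous tw.
(* Zero is rewritten as the integral of the constant 0, so that integrands can be compared. *)
move=> g nSg; rewrite /descent /fibre_integral -[RHS](mul0r (fine (la setT))).
rewrite -(Rintegral_cst la measurableT); apply: eq_Rintegral => al _.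
by apply: fS => Sal; apply: nSg; exists (act al (sec g)); rewrite ?twist_pi_act.
Qed.

End fibre_integral.

End twist_theory.

(** * From complex to real functions *)

Section complex_valued.
Variable R : realType.
Implicit Types z : R[i].

Lemma ler_Re_norm z : `|complex.Re z| <= complex.Re `|z|.
Proof.
by rewrite normc_def /= -sqrtr_sqr ler_wsqrtr// lerDl sqr_ge0.
Qed.

Lemma ler_Im_norm z : `|complex.Im z| <= complex.Re `|z|.
Proof.
by rewrite normc_def /= -sqrtr_sqr ler_wsqrtr// lerDr sqr_ge0.
Qed.

Lemma ler_norm_ReIm z :
  complex.Re `|z| <= `|complex.Re z| + `|complex.Im z|.
Proof.
rewrite normc_def /= -[leRHS]ger0_norm ?addr_ge0// -sqrtr_sqr ler_wsqrtr//.
by rewrite sqrrD !real_normK ?num_real// lerD2r lerDl mulrn_wge0// mulr_ge0.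
Qed.

Lemma complex_continuousP (T : topologicalType) (f : T -> R[i]) :
  continuous (f : T -> (R[i] : numFieldType)) <->
  continuous (fun x => complex.Re (f x)) /\
  continuous (fun x => complex.Im (f x)).
Proof.
split=> [cf|[cr ci] x].
  split=> x; apply/cvgrPdist_lt => e e0.
    have := cf x => /cvgrPdist_lt /(_ (e%:C)%C); rewrite ltcR => /(_ e0).
    apply: filterS => y; rewrite ltcE => /andP[_ /=]; apply: le_lt_trans.
    by rewrite -raddfB; exact: ler_Re_norm.
  have := cf x => /cvgrPdist_lt /(_ (e%:C)%C); rewrite ltcR => /(_ e0).
  apply: filterS => y; rewrite ltcE => /andP[_ /=]; apply: le_lt_trans.
  by rewrite -raddfB; exact: ler_Im_norm.
(* The radius [e] is a complex number: that it is positive means that it is real with positive real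
   part. *)
apply/cvgrPdist_lt => e; rewrite ltcE /= => /andP[/eqP ie re].
have re2 : 0 < complex.Re e / 2 by rewrite divr_gt0.
have := cr x => /cvgrPdist_lt /(_ _ re2) nr.
have := ci x => /cvgrPdist_lt /(_ _ re2) ni.
apply: filterS2 nr ni => y yr yi.
rewrite ltcE ie normc_def /= eqxx /=.
have := ler_norm_ReIm (f x - f y); rewrite {1}normc_def /= => /le_lt_trans.
apply; rewrite (splitr (complex.Re e)).
by apply: ltrD; rewrite raddfB.
Qed.

Lemma CcP (T : lchType) (f : T -> R[i]) : Cc f <->
  rCc (fun x => complex.Re (f x)) /\ rCc (fun x => complex.Im (f x)).
Proof.
split=> [[/complex_continuousP[cr ci] cK]|[/rCcP[cr [K cK rK]] /rCcP[ci [L cL iL]]]].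
  have f0 x : ~ closure [set x | f x != 0] x -> f x = 0.
    move=> nx; apply/eqP; apply: contrapT => /negP fx.
    by apply: nx; exact: subset_closure.
  by split; apply/rCcP; split => //;
    exists (closure [set x | f x != 0]) => // x /f0 ->.
split; first exact/complex_continuousP.
apply: (@closed_subset_compact _ (K `|` L)); first exact: compactU.
move=> x /= fx; apply: contrapT => /not_orP[nK nL].
by move/eqP: fx; apply; apply/eqP; rewrite eq_complex rK// iL// !eqxx.
Qed.

Lemma Cc_real (T : lchType) (f : T -> R) : rCc f -> Cc (fun x => (f x)%:C%C).
Proof.
move=> Cf; apply/CcP; split=> //=; apply/rCcP; split; first exact: cst_continuous.
by exists set0 => //; exact: compact0.
Qed.

Record real_haar_system (H : lchGroupoidType)
    (nu : forall u : H, {measure set (borel u) -> \bar R}) : Prop := {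
  rhs_radon : forall u, units u -> radon (nu u);
  rhs_support : forall u, units u -> msupport (nu u) = rfibre u;
  rhs_continuous : forall f : H -> R, rCc f ->
    {within @units H, continuous (fun u => Rintegral (nu u) setT f)};
  rhs_invariant : forall (a : H) (f : H -> R), rCc f ->
    Rintegral (nu (gsource a)) (rfibre (gsource a)) (fun b => f (gmul a b)) =
    Rintegral (nu (grange a)) setT f
}.

(** [cintegral] is defined by components. One direction tests real functions viewed as complex ones;
    the other treats real and imaginary parts separately. *)
Lemma haar_systemP (H : lchGroupoidType)
    (nu : forall u : H, {measure set (borel u) -> \bar R}) :
  haar_system nu <-> real_haar_system nu.
Proof.
split=> [[rad supp cont inv]|[rad supp cont inv]]; split=> //.
- by move=> f /Cc_real/cont /complex_continuousP[].
- by move=> a f /Cc_real/(inv a) /(congr1 (@complex.Re R)).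
- move=> f /CcP[/cont cr /cont ci].
  exact: ((@complex_continuousP (subspace (@units H))
    (fun u => cintegral (nu u) setT f)).2 (conj cr ci)).
- move=> a f /CcP[/(inv a) er /(inv a) ei].
  by congr Complex.
Qed.

End complex_valued.

(** * The Haar system on [Sigma] *)

Section twisted_haar_system.
Variables (R : realType) (Gamma : lcaGroupType).
Variable la : {measure set (borel (0 : Gamma)) -> \bar R}.
Variables (G Sigma : lchGroupoidType).
Variables (iota : G * Gamma -> Sigma) (pi : Sigma -> G).
Variable lam : forall u : G, {measure set (borel u) -> \bar R}.
Variable sec : G -> Sigma.
Variable mu : forall u : Sigma, {measure set (borel u) -> \bar R}.
Hypothesis Hla : haar_measure la.
Hypothesis tw : twist iota pi.
Hypothesis Hlam : real_haar_system lam.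
Hypothesis secK : forall g, pi (sec g) = g.
Hypothesis mu_radon : forall u, units u -> radon (mu u).
Local Notation act := (twist_act iota pi).
Local Notation desc := (descent iota pi la sec).
Hypothesis mu_fibre : forall u, units u -> forall f : Sigma -> R, rCc f ->
  Rintegral (mu u) setT f = Rintegral (lam (pi u)) (rfibre (pi u)) (desc f).
Let piM := twist_pi_morphism tw.

(** The fibre is the support of [lam (pi u)]. Integrals over all of [G] are the form in which the
    continuity of [lam] and the right side of its invariance are stated. *)
Lemma mu_descent u (f : Sigma -> R) : units u -> rCc f ->
  Rintegral (mu u) setT f = Rintegral (lam (pi u)) setT (desc f).
Proof.
move=> uu Cf; have upi := morphism_units piM uu.
rewrite mu_fibre// -(rhs_support Hlam upi) -rCc_Rintegral_support//.
  exact: rhs_radon.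
exact: rCc_descent.
Qed.

Lemma range_section u g : units u -> rfibre (pi u) g -> grange (sec g) = u.
Proof.
move=> uu ug; apply: (twist_unit_inj tw) => //; first exact: units_range.
by rewrite (morphism_range piM) secK.
Qed.

Lemma twist_msupport u : units u -> msupport (mu u) = rfibre u.
Proof.
move=> uu; have upi := morphism_units piM uu; apply/seteqP; split => x.
  (* If [x] were off the closed fibre, a bump function vanishing on the fibre would have positive
     integral, yet its descent vanishes on [rfibre (pi u)]. *)
  move=> mux; apply: contrapT => xu.
  have oW : open (~` rfibre u) by exact/closed_openC/closed_rfibre.
  have [f [Cf fx f0 fW]] := rCc_bump R oW xu.
  have : 0 < Rintegral (mu u) setT f.
    by apply: rCc_Rintegral_gt0 mux _ => //; [exact: mu_radon|rewrite fx].
  suff -> : Rintegral (mu u) setT f = 0 by rewrite ltxx.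
  rewrite mu_fibre// -[RHS](mul0r (fine (lam (pi u) (rfibre (pi u))))).
  rewrite -Rintegral_cst; last by apply: closed_borel; exact: closed_rfibre.
  apply: eq_Rintegral => g /set_mem /(range_section uu) gu.
  rewrite /descent /fibre_integral -[RHS](mul0r (fine (la setT))).
  rewrite -(Rintegral_cst la measurableT); apply: eq_Rintegral => al _.
  by apply: fW => /=; apply; rewrite /rfibre /= (twist_act_range tw).
(* If [U] were null, a bump function inside it would have zero integral. But its descent is positive
   at [pi x], the integrand being 1 at [al] = 0 and [la] having full support, and [pi x] lies in the
   support of [lam (pi u)]. *)
move=> xu U oU Ux; rewrite lt0e measure_ge0 andbT; apply/negP => /eqP U0.
have [f [Cf fx f0 fU]] := rCc_bump R oU Ux.
have : 0 < Rintegral (mu u) setT f.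
  rewrite mu_descent//; apply: (@rCc_Rintegral_gt0 _ _ _ _ _ (pi x)).
  - exact: rhs_radon.
  - exact: rCc_descent.
  - by move=> g; apply: Rintegral_ge0.
  - by rewrite rhs_support// /rfibre /= -(morphism_range piM) xu.
  - rewrite descent_pi//; apply: (@rCc_Rintegral_gt0 _ _ _ _ _ 0).
    + exact: haar_radon.
    + exact: rCc_fibre.
    + by [].
    + by rewrite haar_msupport.
    + by rewrite twist_act0// fx.
suff -> : Rintegral (mu u) setT f = 0 by rewrite ltxx.
rewrite /Rintegral (@negligible_integral _ _ _ (mu u) setT U)//.
- rewrite (eq_integral (cst 0%E)) ?integral0// => y /set_mem[_ /fU fy].
  by rewrite /= fy.
- exact: open_borel.
- by apply: rCc_integrable => //; exact: mu_radon.
Qed.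

Lemma twist_haar_continuous (f : Sigma -> R) : rCc f ->
  {within @units Sigma, continuous (fun u => Rintegral (mu u) setT f)}.
Proof.
move=> Cf.
apply: (@subspace_eq_continuous _ _ _
  (fun u => Rintegral (lam (pi u)) setT (desc f))).
  by move=> u /set_mem uu; exact: esym (mu_descent uu Cf).
apply/subspace_continuousP => u uu N.
have upi := morphism_units piM uu.
have /subspace_continuousP := rhs_continuous Hlam (rCc_descent tw Hla secK Cf).
move=> /(_ _ upi N) /[apply] /(twist_pi_continuous tw).
rewrite /nbhs /=; apply: filterS => x /= + ux; apply.
exact: morphism_units ux.
Qed.

(* Left translation by [a] only acts on a range fibre, so [f (gmul a b)] is
   extended from the closed set [rfibre (gsource a)] by Tietze's theorem. *)
Lemma twist_haar_invariant (a : Sigma) (f : Sigma -> R) : rCc f ->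
  Rintegral (mu (gsource a)) (rfibre (gsource a)) (fun b => f (gmul a b)) =
  Rintegral (mu (grange a)) setT f.
Proof.
move=> Cf; have /rCcP[cf [S cS fS]] := Cf.
have [g [Cg gf _]] : exists g : Sigma -> R, [/\ rCc g,
    (forall b, rfibre (gsource a) b -> g b = f (gmul a b)) &
    forall b, ~ setT b -> g b = 0].
  (* On the fibre, f(a b) vanishes unless the product a b lies in [S]; as its range is that of [a],
     this puts [b] in the given translate. *)
  apply: (@rCc_extension _ _ _ _ (gmul (ginv a) @` (S `&` rfibre (grange a)))).
  - exact: closed_rfibre.
  - move=> b.
    apply: (@continuous_comp (subspace (rfibre (gsource a))) _ _ (gmul a) f).
      exact: gmull_continuous.
    exact: cf.
  - apply: continuous_compact.
      apply: (@continuous_subspaceW _ _ _ (rfibre (gsource (ginv a)))).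
        by rewrite gsourceV; exact: subIsetr.
      exact: gmull_continuous.
    by apply: compact_closedI => //; exact: closed_rfibre.
  - move=> b ab nK; apply: fS => Sab; apply: nK; exists (gmul a b).
      by split => //; rewrite /rfibre /= grangeM//; exact: source_range_composable.
    by rewrite gmulKE.
  - exact: openT.
  - by [].
have us := units_source a.
transitivity (Rintegral (mu (gsource a)) (rfibre (gsource a)) g).
  by apply: eq_Rintegral => b /set_mem ab; rewrite gf.
rewrite -(twist_msupport us) -rCc_Rintegral_support//; last exact: mu_radon.
rewrite (mu_fibre us Cg) (mu_descent (units_range a) Cf).
rewrite (morphism_range piM) (morphism_source piM).
rewrite -(rhs_invariant Hlam (pi a) (rCc_descent tw Hla secK Cf)).
apply: eq_Rintegral => h /set_mem ah.
have sh : grange (sec h) = gsource a.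
  by apply: range_section => //; rewrite (morphism_source piM).
(* As h = pi(sec(h)), the product of pi(a) with h is the image under [pi] of a sec(h), where the
   descent is the fibre integral; [twist_act_mul] then matches the integrands. *)
rewrite -[in RHS](secK h) -(morphismM piM)// descent_pi//.
apply: eq_Rintegral => al _.
by rewrite gf /rfibre /= ?(twist_act_range tw)// (twist_act_mul tw).
Qed.

Lemma twist_haar_system : real_haar_system mu.
Proof.
split.
- exact: mu_radon.
- exact: twist_msupport.
- exact: twist_haar_continuous.
- exact: twist_haar_invariant.
Qed.

End twisted_haar_system.

Theorem theorem3p2 (R : realType) (Gamma : lcaGroupType)
    (la : {measure set (borel (0 : Gamma)) -> \bar R})
    (G Sigma : lchGroupoidType)
    (iota : G * Gamma -> Sigma) (pi : Sigma -> G)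
    (lam : forall u : G, {measure set (borel u) -> \bar R})
    (sec : G -> Sigma)
    (mu : forall u : Sigma, {measure set (borel u) -> \bar R}) :
  haar_measure la ->
  twist iota pi ->
  haar_system lam ->
  (forall g, pi (sec g) = g) ->
  (forall u, units u ->
    radon (mu u) /\
    forall f : Sigma -> R[i], Cc f ->
      cintegral (mu u) setT f =
      cintegral (lam (pi u)) (rfibre (pi u)) (fun g =>
        cintegral la setT (fun al => f (twist_act iota pi al (sec g))))) ->
  haar_system mu.
Proof.
move=> Hla tw /haar_systemP Hlam secK Hmu; apply/haar_systemP.
apply: (twist_haar_system Hla tw Hlam secK) => [u uu|u uu f Cf].
  by have [] := Hmu u uu.
(* The complex formula for [mu] is tested on a real function, and its real part is kept. *)
by have [_ /(_ _ (Cc_real Cf)) /(congr1 (@complex.Re R))] := Hmu u uu.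
Qed.
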